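(* Let $n\ge0$ be an integer and $b=2(2n+1)$. Then there is no infinite smooth word over $\{1,b\}$ that is an infinite Lyndon word.
   Context: Words are compared lexicographically with $1<b$. For a word $w$ over $\{1,b\}$ written as maximal blocks $\alpha_0^{i_0}\alpha_1^{i_1}\cdots$ ($\alpha_{k+1}\ne\alpha_k$, $i_k\ge1$), $\Delta(w)=i_0i_1\cdots$. An infinite word $w\in\{1,b\}^\omega$ is smooth if $\Delta^k(w)\in\{1,b\}^\omega$ for all $k\ge0$. An infinite Lyndon word is an infinite word strictly smaller than each of its proper suffixes. *)

(* Defs.v *)
From mathcomp Require Import all_boot.

Set Implicit Arguments.
Unset Strict Implicit.
Unset Printing Implicit Defensive.

Definition word := nat -> nat.

Definition word_over (a b : nat) (w : word) : Prop :=
  forall i, w i = a \/ w i = b.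

(* Delta is partial on infinite words: [is_Delta w d] says that w is the
   concatenation of the maximal blocks alpha_k ^ (d_k), k = 0, 1, ..., so it
   has no solution d when w is eventually constant. *)
Definition is_Delta (w d : word) : Prop :=
  exists alpha : word,
    [/\ forall k, alpha k.+1 <> alpha k,
        forall k, 1 <= d k
      & forall k j, j < d k -> w (\sum_(i < k) d i + j) = alpha k].

(* [is_Delta_iter k w v] : Delta^k(w) is defined and equal to v. *)
Fixpoint is_Delta_iter (k : nat) (w v : word) : Prop :=
  if k is k'.+1 then exists2 u, is_Delta_iter k' w u & is_Delta u v
  else w =1 v.

Definition smooth (b : nat) (w : word) : Prop :=
  forall k, exists2 v, is_Delta_iter k w v & word_over 1 b v.

Definition lex_lt (u v : word) : Prop :=
  exists2 k, forall i, i < k -> u i = v i & u k < v k.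

Definition suffix_from (m : nat) (w : word) : word := fun i => w (m + i).

Definition infinite_Lyndon (w : word) : Prop :=
  forall m, 0 < m -> lex_lt w (suffix_from m w).

(* Main.v *)
Require Import Defs.
From mathcomp Require Import all_boot zify.

(* Let u_k code Delta^k(w) as a boolean word ([true] for b). Processing one more letter of u_k moves the
   positions inside u_0, ..., u_(k-1), and what matters is only which letter comes next at each of these levels:
   the k booleans form a state on which each letter acts by a permutation. For k <= 4 these permutations have
   order dividing 4, so that b = 2 mod 4 steps amount to two. The Lyndon property pushed up to u_k says: among
   the suffixes of u_k read from a given state, the prefix is minimal for an order twisted by the state at the
   first difference. Comparing with well-chosen suffixes forbids letters or runs in certain states of u_2, u_3
   or u_4, and a bounded search in the automaton left over closes every choice of the first letters of the u_k.
   For b = 2 the word w itself is searched: every choice of the first ten letters u_0(0), ..., u_9(0) forces a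
   prefix of w that has a smaller factor. *)

Set Implicit Arguments.
Unset Strict Implicit.
Unset Printing Implicit Defensive.

(** * Boolean coding of smooth words and of their run lengths *)

Section Runs.

Variable b : nat.

Definition len (x : bool) := if x then b else 1.

Definition pos (v : nat -> bool) k := \sum_(i < k) len (v i).

Definition runs (u v : nat -> bool) :=
  forall k j, j < len (v k) -> u (pos v k + j) = u 0 (+) odd k.

Definition smooth_bits (u : nat -> bool) :=
  exists2 w, smooth b w & forall i, u i = (w i == b).

End Runs.

(** By induction the blocks of both decompositions start at the same places: a longer block would
    contain the position where the shorter one has already changed letter. *)
Lemma is_Delta_inj w d d' : is_Delta w d -> is_Delta w d' -> d =1 d'.
Proof.
move=> [a [aN d_gt0 aE]] [a' [a'N d'_gt0 a'E]].
have lek (x y : word) (c c' : word) k :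
    (forall k, c k.+1 <> c k) -> (forall k, 0 < x k) -> (forall k, 0 < y k) ->
    (forall k j, j < x k -> w (\sum_(i < k) x i + j) = c k) ->
    (forall k j, j < y k -> w (\sum_(i < k) y i + j) = c' k) ->
    \sum_(i < k) x i = \sum_(i < k) y i -> y k <= x k.
  move=> cN x0 y0 cE c'E eqS; rewrite leqNgt; apply/negP => lt_xy.
  apply: (cN k).
  have := cE k.+1 0 (x0 _); rewrite addn0 big_ord_recr /= eqS c'E // => <-.
  by have := cE k 0 (x0 _); rewrite eqS c'E.
suff eqS k : \sum_(i < k) d i = \sum_(i < k) d' i.
  move=> k; apply/eqP; rewrite eqn_leq.
  by rewrite (lek d' d a' a) ?(lek d d' a a').
elim: k => [|k IHk]; first by rewrite !big_ord0.
rewrite !big_ord_recr /= IHk; congr (_ + _); apply/eqP; rewrite eqn_leq.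
by rewrite (lek d' d a' a) ?(lek d d' a a').
Qed.

Lemma eq_is_Delta w w' d : w =1 w' -> is_Delta w d -> is_Delta w' d.
Proof.
by move=> eqw [a [aN d0 aE]]; exists a; split=> // k j /aE; rewrite eqw.
Qed.

Lemma eq_is_Delta_iter k w w' v :
  w =1 w' -> is_Delta_iter k w v -> is_Delta_iter k w' v.
Proof.
elim: k v => [|k IHk] v eqw /=; first by move=> + i => /(_ i); rewrite eqw.
by case=> u wu uv; exists u => //; apply: IHk.
Qed.

Lemma is_Delta_iterS k w v :
  is_Delta_iter k.+1 w v -> exists2 d, is_Delta w d & is_Delta_iter k d v.
Proof.
elim: k v => [|k IHk] v; first by case=> u wu uv; exists v => //=; apply: eq_is_Delta uv => i.
by case=> u /IHk[d wd du] uv; exists d => //; exists u.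
Qed.

Lemma smooth_Delta b w : smooth b w -> exists2 d, is_Delta w d & smooth b d.
Proof.
move=> sw; have [v /is_Delta_iterS[d wd _] _] := sw 1.
exists d => // k; have [v' /is_Delta_iterS[d' wd' dv'] ov'] := sw k.+1.
by exists v' => //; apply: eq_is_Delta_iter dv'; apply: is_Delta_inj wd' wd.
Qed.

Lemma smooth_over b w : smooth b w -> word_over 1 b w.
Proof. by move=> /(_ 0)[v eqw ov] i; rewrite eqw. Qed.

Lemma smooth_bits_runs b u :
  1 < b -> smooth_bits b u -> exists2 v, smooth_bits b v & runs b u v.
Proof.
move=> b_gt1 [w sw uE]; have [d [a [aN d0 aE]] sd] := smooth_Delta sw.
exists (fun i => d i == b); first by exists d.
have lenE i : len b (d i == b) = d i.
  by rewrite /len; case: eqVneq => [->|db] //; case: (smooth_over sd i) => // /eqP; rewrite (negPf db).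
have posE k : pos b (fun i => d i == b) k = \sum_(i < k) d i.
  by apply: eq_bigr => i _; rewrite lenE.
have aw k : a k = 1 \/ a k = b.
  by rewrite -(aE k 0 (d0 k)); apply: smooth_over.
have a_b k : (a k == b) = u 0 (+) odd k.
  elim: k => [|k IHk]; first by rewrite addbF uE -(aE 0 0 (d0 0)) big_ord0.
  rewrite /= addbN -IHk; case: (aw k.+1) (aw k) (aN k) => -> [] ->; rewrite ?eqxx //; lia.
by move=> k j; rewrite lenE posE uE => /aE->.
Qed.

(** * States of the automaton and the words valid for it *)

(* A state of level k.+1 records a state of level k and the letter of the run about to be read. *)
Fixpoint state k : Type := if k is k'.+1 then (state k' * bool)%type else unit.

(** The letter b means a run of b equal steps one level down; by [step4] and [iter_b] these amount
    to two. *)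
Fixpoint step k : bool -> state k -> state k :=
  match k with
  | 0 => fun _ s => s
  | k'.+1 => fun x s =>
      (if x then step s.2 (step s.2 s.1) else step s.2 s.1, ~~ s.2)
  end.

(* The letter that a shifted copy of a minimal word may have where it first differs from the word: the next
   letter of the lower level tells which of the two run lengths is the longer one. *)
Fixpoint allowed k : state k -> bool :=
  match k with
  | 0 => fun=> true
  | k'.+1 => fun s => s.2 == allowed (step s.2 s.1)
  end.

Fixpoint state_at k (s : state k) (u : nat -> bool) i : state k :=
  if i is i'.+1 then step (u i') (state_at s u i') else s.

Lemma state_at0 k (s : state k) u : state_at s u 0 = s.
Proof. by []. Qed.

Lemma state_atS k (s : state k) u i : state_at s u i.+1 = step (u i) (state_at s u i).
Proof. by []. Qed.

Lemma state_at_add k (s : state k) u i j :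
  state_at s u (i + j) = state_at (state_at s u i) (fun t => u (i + t)) j.
Proof. by elim: j => [|j IHj]; rewrite ?addn0 // addnS /= IHj. Qed.

Lemma state_at_const k (s : state k) u c j :
  (forall i, i < j -> u i = c) -> state_at s u j = iter j (step c) s.
Proof.
by elim: j => //= j IHj uE; rewrite uE // IHj // => i /ltnW; apply: uE.
Qed.

Lemma step4 k c (s : state k) : k <= 4 -> iter 4 (step c) s = s.
Proof.
case: k s => [|[|[|[|[|//]]]]] s _.
- by [].
- by case: s => [[]] []; case: c.
- by case: s => [[[]]] [] []; case: c.
- by case: s => [[[[]]]] [] [] []; case: c.
- by case: s => [[[[[]]]]] [] [] [] []; case: c.
Qed.

(* Only the first four letters of a run of length b are tested: this is enough since b >= 6 will hold. *)
Definition lift_ok k (ok : bool -> state k -> bool) x (s : state k.+1) :=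
  if x then all (fun j => ok s.2 (iter j (step s.2) s.1)) (iota 0 4)
  else ok s.2 s.1.

Fixpoint extendable k (ok : bool -> state k -> bool) N s :=
  if N is N'.+1 then
    (ok false s && extendable ok N' (step false s)) || (ok true s && extendable ok N' (step true s))
  else true.

Definition valid k (ok : bool -> state k -> bool) s u :=
  forall i, ok (u i) (state_at s u i).

Lemma valid_drop k (ok : bool -> state k -> bool) s u m :
  valid ok s u -> valid ok (state_at s u m) (fun i => u (m + i)).
Proof. by move=> v i; rewrite -state_at_add; apply: v. Qed.

(** Meant for contraposition: once [extendable] computes to false, no valid infinite word starts in
    [s]. *)
Lemma valid_ext k (ok : bool -> state k -> bool) s u N : valid ok s u -> extendable ok N s.
Proof.
elim: N s u => // N IHN s u v.
have := v 0; have := IHN _ _ (valid_drop 1 v).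
by rewrite /=; case: (u 0) => /= -> ->; rewrite ?orbT.
Qed.

Lemma valid_next k (ok : bool -> state k -> bool) s u N i :
  valid ok s u -> ok (u i) (state_at s u i) && extendable ok N (step (u i) (state_at s u i)).
Proof.
move=> v; rewrite v /=.
by have := valid_ext N (valid_drop i.+1 v).
Qed.

(** Only suffixes read from the same state as the one at [r] are compared; [r] will be 0 or 1. *)
Definition minimal_at k (s : state k) u r :=
  forall m j, state_at s u m = state_at s u r ->
    (forall i, i < j -> u (m + i) = u (r + i)) -> u (m + j) != u (r + j) ->
    u (m + j) = allowed (state_at s u (r + j)).

(** * Transfer of validity and minimality from a word to its run lengths *)

Section Lift.

Variables (n : nat) (n_gt0 : 0 < n).
Let b := 2 * (2 * n + 1).

Lemma iter_b T (f : T -> T) x : iter 4 f x = x -> iter b f x = iter 2 f x.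
Proof.
move=> f4; have -> : b = 2 + n * 4 by rewrite /b; lia.
rewrite iterD; congr (iter 2 _ _).
by elim: n => // p IHp; rewrite mulSn iterD IHp f4.
Qed.

Lemma posS v i : pos b v i.+1 = pos b v i + len b (v i).
Proof. by rewrite /pos big_ord_recr. Qed.

Lemma len_gt0 x : 0 < len b x.
Proof. by case: x; rewrite //= /b muln_gt0 addn1. Qed.

Lemma runs0 u v i : runs b u v -> u (pos b v i) = u 0 (+) odd i.
Proof. by move=> uv; have := uv _ _ (len_gt0 (v i)); rewrite addn0. Qed.

Lemma pos0 v : pos b v 0 = 0.
Proof. by rewrite /pos big_ord0. Qed.

Lemma pos1 v : pos b v 1 = len b (v 0).
Proof. by rewrite posS pos0. Qed.

Lemma run0 u v j : runs b u v -> j < len b (v 0) -> u j = u 0.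
Proof. by move=> uv /uv; rewrite pos0 addbF. Qed.

Lemma run1 u v : runs b u v -> u (len b (v 0)) = ~~ u 0.
Proof. by move=> uv; rewrite -pos1 (runs0 _ uv) addbT. Qed.

Lemma run_end u v i : runs b u v ->
  exists2 q, pos b v i.+1 = q.+1 & u q = u 0 (+) odd i.
Proof.
move=> uv; exists (pos b v i + (len b (v i)).-1).
  by rewrite posS -addnS prednK ?len_gt0.
by rewrite uv // prednK ?len_gt0.
Qed.

Section Runs.

Variables (k : nat) (k_le4 : k <= 4) (s : state k) (u v : nat -> bool).
Hypothesis uv : runs b u v.

Lemma state_at_run i j : j <= len b (v i) ->
  state_at s u (pos b v i + j) = iter j (step (u 0 (+) odd i)) (state_at s u (pos b v i)).
Proof.
move=> le_j; rewrite state_at_add; apply: state_at_const => t lt_tj.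
by rewrite uv // (leq_trans lt_tj).
Qed.

Lemma state_at_lift i :
  state_at ((s, u 0) : state k.+1) v i = (state_at s u (pos b v i), u 0 (+) odd i).
Proof.
elim: i => [|i IHi]; first by rewrite /= /pos big_ord0 addbF.
rewrite posS state_at_run // [LHS]/= IHi [_.2]/= [_.1]/= addbN; congr pair.
by case: (v i) => //; rewrite [len _ _]/= iter_b ?step4.
Qed.

Lemma lift_valid ok :
  valid ok s u -> valid (lift_ok ok) ((s, u 0) : state k.+1) v.
Proof.
move=> vu i; rewrite state_at_lift /lift_ok [_.2]/= [_.1]/=.
have okj j : j < len b (v i) ->
    ok (u 0 (+) odd i) (iter j (step (u 0 (+) odd i)) (state_at s u (pos b v i))).
  by move=> lt_j; rewrite -state_at_run ?(ltnW lt_j) // -(uv lt_j); apply: vu.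
case: (v i) okj => okj; last exact: (okj 0).
by apply/allP => j; rewrite mem_iota => j4; apply: okj; rewrite /= /b; lia.
Qed.

(** The first differing runs have lengths 1 and b, so the words below first differ at the second
    letter of these runs, where only the long one still shows [c]. *)
Lemma lift_diff m r j :
  state_at ((s, u 0) : state k.+1) v m = state_at ((s, u 0) : state k.+1) v r ->
  (forall i, i < j -> v (m + i) = v (r + i)) -> v (m + j) != v (r + j) ->
  exists J, let c := u 0 (+) odd (r + j) in
    [/\ forall i, i <= J -> u (pos b v m + i) = u (pos b v r + i),
        u (pos b v m + J.+1) = (c == v (m + j)),
        u (pos b v r + J.+1) = (c == v (r + j))
      & state_at s u (pos b v r + J.+1) = step c (state_at s u (pos b v (r + j)))].
Proof.
rewrite !state_at_lift // => -[eq_st eq_par] eqv neqv.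
have par i : odd (m + i) = odd (r + i).
  by rewrite !oddD; congr (_ (+) _); apply: (can_inj (addKb (u 0))).
have posD x i : pos b v (x + i) = pos b v x + \sum_(t < i) len b (v (x + t)).
  by elim: i => [|i IHi]; rewrite ?big_ord0 ?addn0 // addnS posS IHi big_ord_recr /= addnA.
pose P i := \sum_(t < i) len b (v (r + t)).
have PE i : i <= j -> \sum_(t < i) len b (v (m + t)) = P i.
  by move=> le_ij; apply: eq_bigr => t _; rewrite eqv // (leq_trans _ le_ij).
(* [P j] is the total length of the agreeing runs, hence [(P j).+1] the offset of the second letter
   of the differing run. *)
exists (P j) => c.
have eqrun i t : i < j -> t < len b (v (r + i)) ->
    u (pos b v m + (P i + t)) = u (pos b v r + (P i + t)).
  move=> lt_ij lt_t; rewrite !addnA -[in LHS](PE _ (ltnW lt_ij)) -!posD.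
  by rewrite [LHS]uv ?eqv // uv // par.
have cE x (e : odd (x + j) = odd (r + j)) (eP : \sum_(t < j) len b (v (x + t)) = P j) :
    u (pos b v x + P j) = c /\ u (pos b v x + (P j).+1) = (c == v (x + j)).
  split; first by rewrite -eP -posD (runs0 _ uv) e.
  rewrite -addn1 addnA -eP -posD; case vx: (v (x + j)).
    by rewrite uv; [rewrite e -/c; case: (c) | rewrite vx /= /b; lia].
  have -> : pos b v (x + j) + 1 = pos b v (x + j).+1 by rewrite posS vx.
  by rewrite (runs0 _ uv) /= e addbN -/c; case: (c).
have [um0 um1] := cE m (par j) (PE j (leqnn _)).
have [ur0 ur1] := cE r erefl erefl.
split=> //.
- move=> i; rewrite leq_eqVlt => /orP[/eqP->|]; first by rewrite um0 ur0.
  have : forall l, l <= j -> i < P l ->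
      u (pos b v m + i) = u (pos b v r + i).
    elim=> [|l IHl] lt_lj; first by rewrite /P big_ord0.
    rewrite /P big_ord_recr /= -/(P l); case: (ltnP i (P l)) => [lt _|ge lt].
      exact: IHl (ltnW lt_lj) lt.
    by rewrite -(subnKC ge); apply: eqrun => //; rewrite ltn_subLR.
  by move=> /(_ _ (leqnn j)).
- by rewrite -addn1 addnA -posD (state_at_run (len_gt0 _)).
Qed.

(** Below, the shifted copy must show the allowed letter; its differing run is long exactly when
    that letter is [c], which is the recursion defining [allowed]. *)
Lemma lift_minimal r :
  minimal_at s u (pos b v r) -> minimal_at ((s, u 0) : state k.+1) v r.
Proof.
move=> minu m j eq_st eqv neqv.
have [J [eqJ um ur stE]] := lift_diff eq_st eqv neqv.
move: eq_st; rewrite !state_at_lift => -[eq_st _].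
have := minu _ J.+1 eq_st eqJ; rewrite um ur stE /=.
case: (_ (+) _) neqv; case: (v (m + j)); case: (v (r + j)); case: allowed => //= _;
  by move/(_ isT).
Qed.

(* The suffix at 0 of [u] is a first run of length 1 followed by [v] from 1, so it can also be compared with
   the suffixes that start at the last letter of a longer run. *)
Lemma lift_minimal1 :
  v 0 = false -> minimal_at s u 0 -> minimal_at ((s, u 0) : state k.+1) v 1.
Proof.
move=> v0 minu m j eq_st eqv neqv.
have [J [eqJ um ur stE]] := lift_diff eq_st eqv neqv.
have pos_1 : pos b v 1 = 1 by rewrite pos1 v0.
move: eq_st; rewrite !state_at_lift => -[eq_st].
case: m => [|m] in eqv neqv eqJ um eq_st *; first by case: (u 0).
move=> par; have c0 : u 0 (+) odd m = u 0.
  by move: par => /=; case: (u 0); case: (odd m).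
(* [Q] is the last position of the preceding run. It carries the letter [u 0], so by injectivity of
   [step] it has the state of position 0, and the suffixes at [Q] and 0 can be compared. *)
have [Q QE] := run_end m uv; rewrite c0 => uQ.
have stQ : state_at s u Q = state_at s u 0.
  have inj (x y : state k) : step (u 0) x = step (u 0) y -> x = y.
    by move=> e; rewrite -[x](step4 (u 0)) // -[y](step4 (u 0)) // !iterSr e.
  by apply: inj; move: eq_st; rewrite QE pos_1 /= uQ.
have uQS : u (Q + J.+2) = (u 0 (+) odd (1 + j) == v (m.+1 + j)).
  by rewrite -um QE addSnnS.
have u0S : u (0 + J.+2) = (u 0 (+) odd (1 + j) == v (1 + j)) by rewrite -ur pos_1.
have -> : allowed ((state_at s u (pos b v (1 + j)), u 0 (+) odd (1 + j)) : state k.+1) =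
          (u 0 (+) odd (1 + j) == allowed (state_at s u (0 + J.+2))).
  by have -> : 0 + J.+2 = pos b v 1 + J.+1; [rewrite pos_1 | rewrite stE].
have minQ : u (Q + J.+2) != u (0 + J.+2) -> u (Q + J.+2) = allowed (state_at s u (0 + J.+2)).
  apply: minu => //.
  case=> [|i] lt_i; first by rewrite addn0 uQ.
  have -> : 0 + i.+1 = pos b v 1 + i by rewrite pos_1.
  by rewrite -addSnnS -QE eqJ.
move: minQ neqv; rewrite uQS u0S.
case: (_ (+) _); case: (v (m.+1 + j)); case: (v (1 + j)); case: allowed => //=;
  by move=> /(_ isT).
Qed.

End Runs.
End Lift.

(** * Exhaustive search over first letters, for b = 2 *)

Section Search.

Variable b : nat.
Hypothesis b_gt1 : 1 < b.

(** The last [[:: c]] opens the run after the known ones: its letter is forced by alternation,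
    whatever its length. *)
Fixpoint expand c (s : seq bool) :=
  if s is x :: s' then nseq (len b x) c ++ expand (~~ c) s' else [:: c].

Definition is_prefix (s : seq bool) (u : nat -> bool) :=
  forall i, i < size s -> u i = nth false s i.

Lemma expand_prefix u v s :
  runs b u v -> is_prefix s v -> is_prefix (expand (u 0) s) u.
Proof.
move=> uv.
suff gen k : is_prefix s (fun i => v (k + i)) ->
    is_prefix (expand (u 0 (+) odd k) s) (fun i => u (pos b v k + i)).
  by move=> /(gen 0); rewrite addbF /pos big_ord0.
elim: s k => [|x s IHs] k vs i /=.
  case: i => // _; rewrite uv //; case: (v k) => //=; exact: ltnW.
have vk : v k = x by have := vs 0 isT; rewrite addn0.
rewrite nth_cat size_cat size_nseq nth_nseq; case: (ltnP i (len b x)) => [lt_i _|le_i lt_i].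
  by rewrite uv // vk.
have vs' : is_prefix s (fun i => v (k.+1 + i)).
  by move=> j lt_j; have := vs j.+1 lt_j; rewrite addnS.
have := IHs _ vs' (i - len b x).
rewrite /= addbN ltn_subLR // => /(_ lt_i) <-.
by rewrite /pos big_ord_recr /= vk -addnA subnKC.
Qed.

Fixpoint word_of (phi : seq bool) :=
  if phi is c :: phi' then expand c (word_of phi') else [::].

Fixpoint first_letters (phi : seq bool) (u : nat -> bool) : Prop :=
  if phi is c :: phi' then
    u 0 = c /\ exists v, [/\ smooth_bits b v, runs b u v & first_letters phi' v]
  else True.

Lemma firsts_prefix phi u : first_letters phi u -> is_prefix (word_of phi) u.
Proof.
elim: phi u => [|c phi IHphi] u //= [<- [v [_ uv /IHphi]]].
exact: expand_prefix.
Qed.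

Lemma firsts_rcons phi u : smooth_bits b u -> first_letters phi u ->
  exists c, first_letters (rcons phi c) u.
Proof.
elim: phi u => [|c phi IHphi] u su /=.
  have [v sv uv] := smooth_bits_runs b_gt1 su.
  by exists (u 0); split=> //; exists v.
case=> u0 [v [sv uv /(IHphi _ sv)[c' fv]]].
by exists c'; split=> //; exists v.
Qed.

(** Also false when one list is a prefix of the other, as the known letters then decide nothing. *)
Fixpoint smaller (s t : seq bool) :=
  match s, t with
  | x :: s', y :: t' => if x == y then smaller s' t' else y
  | _, _ => false
  end.

Fixpoint search N phi :=
  (let w := word_of phi in
   has (fun m => smaller (drop m w) w) (iota 0 (size w))) ||
  if N is N'.+1 then all (fun c => search N' (rcons phi c)) [:: false; true]
  else false.

Definition lyndon_bits (u : nat -> bool) :=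
  forall m j, (forall i, i < j -> u (m + i) = u i) -> u (m + j) != u j ->
    u (m + j).

Lemma smallerP (u v : nat -> bool) s t : is_prefix s u -> is_prefix t v -> smaller s t ->
  exists j, [/\ forall i, i < j -> u i = v i, u j = false & v j].
Proof.
elim: s t u v => [|x s IHs] [|y t] u v //= us vt.
have [u0 v0] : u 0 = x /\ v 0 = y by split; [apply: (us 0) | apply: (vt 0)].
case: eqVneq => [exy|nxy] lt_st.
  have [j [eqj uj vj]] := IHs t (u \o S) (v \o S) (fun i => us i.+1) (fun i => vt i.+1) lt_st.
  by exists j.+1; split=> // -[|i]; [rewrite u0 v0|apply: eqj].
by exists 0; split=> //; rewrite ?v0 // u0; move: nxy lt_st; case: (x); case: (y).
Qed.

Lemma search_sound N phi u : search N phi ->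
  smooth_bits b u -> lyndon_bits u -> ~ first_letters phi u.
Proof.
elim: N phi => [|N IHN] phi /= /orP[] // => [/hasP[m _ lt_m]|/hasP[m _ lt_m]|].
1,2: move=> su lu /firsts_prefix pu.
1,2: have dpu : is_prefix (drop m (word_of phi)) (fun i => u (m + i))
  by move=> i; rewrite size_drop nth_drop => lt_i; apply: pu; rewrite -ltn_subRL.
1,2: have [j [eqj uj vj]] := smallerP dpu pu lt_m.
1,2: by have := lu m j eqj; rewrite vj uj => /(_ isT).
move=> /and3P[f0 f1 _] su lu /(firsts_rcons su)[[] fu].
  exact: IHN f1 su lu fu.
exact: IHN f0 su lu fu.
Qed.

End Search.

Lemma no_lyndon2 u : smooth_bits 2 u -> ~ lyndon_bits u.
Proof.
move=> su lu; suff: search 2 10 [::] by move/search_sound => /(_ isT _ su lu); apply.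
by vm_compute.
Qed.

Lemma smooth_bits_lyndon b w : smooth b w -> infinite_Lyndon w ->
  1 < b -> lyndon_bits (fun i => w i == b).
Proof.
move=> /smooth_over ow lw b_gt1 m j eqj neqj.
case: m => [|m] in eqj neqj *; first by rewrite eqxx in neqj.
have [k eqk ltk] := lw m.+1 isT.
have inj i i' : (w i == b) = (w i' == b) -> w i = w i'.
  by case: (ow i) (ow i') => -> [] ->; rewrite ?eqxx //; lia.
case: (ltngtP k j) => [/eqj/inj eqkj|/eqk eqjk|ekj].
- by move: ltk; rewrite /suffix_from eqkj ltnn.
- by rewrite eqjk eqxx in neqj.
- rewrite -ekj; case: (ow k) (ow (m.+1 + k)) ltk => -> []; rewrite /suffix_from => ->; lia.
Qed.

(** * The case b >= 6: determining the first letters level by level *)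

Section Main.

Variables (n : nat) (n_gt0 : 0 < n).
Let b := 2 * (2 * n + 1).

Let b_gt1 : 1 < b. Proof. by rewrite /b; lia. Qed.

Lemma state_at_level1 c u k : state_at ((tt, c) : state 1) u k = (tt, c (+) odd k).
Proof. by elim: k => [|k /= ->]; rewrite ?addbF //= addbN; case: (u k). Qed.

(* Runs of b that are never long sit in one parity class of positions, so the runs of 1 between two of them have
   odd length, hence length 1 as b is even: two levels up the word is eventually constant. *)
Lemma no_short_class u p : smooth_bits b u ->
  ~ forall k, odd k = p -> u k = false.
Proof.
move=> su short.
have vu : valid (fun x (s : state 1) => ~~ (x && (s.2 == p))) (tt, false) u.
  by move=> k; rewrite state_at_level1; case: (boolP (u k)) => // uk; apply/eqP => /short; rewrite uk.
have [u1 su1 uu1] := smooth_bits_runs b_gt1 su.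
have [u2 su2 u12] := smooth_bits_runs b_gt1 su1.
have vu1 := lift_valid n_gt0 (isT : 1 <= 4) uu1 vu.
have := valid_ext 4 (lift_valid n_gt0 (isT : 2 <= 4) u12 vu1).
by case: p (u 0) (u1 0) {short vu vu1} => [] [] [].
Qed.

Lemma no_lyndon_start u : smooth_bits b u -> lyndon_bits u -> u 0 = false.
Proof.
move=> su lu; apply/negP => u0.
have [v sv uv] := smooth_bits_runs b_gt1 su.
have u1 : u (pos b v 1) = false by rewrite (runs0 _ uv) /= u0.
by have := lu (pos b v 1) 0 (fun i e => False_ind _ (notF e)); rewrite addn0 u1 u0 => /(_ isT).
Qed.

(** Start states of u_2, ..., u_5: the first letters of u_0, ..., u_4 turn out to be 1, b, 1, b,
    b. *)
Let s2 : state 2 := ((tt, false), true).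
Let s3 : state 3 := (s2, false).
Let s4 : state 4 := (s3, true).
Let s5 : state 5 := (s4, true).

Let le1 : 1 <= 4. Proof. by []. Qed.
Let le2 : 2 <= 4. Proof. by []. Qed.
Let le3 : 3 <= 4. Proof. by []. Qed.

(** At even positions the allowed letter is 1, so a word starting with 1 would have no b there,
    against [no_short_class]. *)
Lemma level1_start u : smooth_bits b u ->
  minimal_at ((tt, false) : state 1) u 0 -> u 0 = true.
Proof.
move=> su minu; apply/negP => /negP/negbTE u0; apply: (@no_short_class u false su) => k ek.
apply/negP => uk; have := minu k 0; rewrite !addn0 !state_at_level1 ek u0 uk.
by move=> /(_ erefl (fun i e => False_ind _ (notF e)) isT).
Qed.

(** If u_1 started with bb, no run of b in it could have its last letter at an even position, since
    b1 precedes bb in the twisted order there; the search then closes. *)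
Lemma level2_start u v : smooth_bits b v -> runs b u v -> u 0 = true ->
  minimal_at ((tt, false) : state 1) u 0 -> v 0 = false.
Proof.
move=> sv uv u0 minu; apply/negP => v0.
have u1 : u 1 = true by rewrite (run0 uv) ?v0.
pose ok x (s : state 2) := s.2 ==> ~~ (step x s).1.2.
have vv : valid ok s2 v.
  move=> i; rewrite /ok -/(state_at _ _ i.+1) -[s2]/((tt, false), true) -u0.
  rewrite !(state_at_lift n_gt0 le1 _ uv) u0 /=; apply/implyP => oi.
  have [q qE] := run_end i uv; rewrite u0 /= => uq.
  rewrite state_at_level1 qE /=; apply/negP => oq.
  have := minu q 1; rewrite !addn1 u1 -qE (runs0 _ uv) u0 !state_at_level1 /=.
  rewrite oi (negbTE oq) => /(_ erefl) H; have : false = true; last by [].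
  by apply: H => // -[|//] _; rewrite addn0 uq u0 oi.
have [w sw vw] := smooth_bits_runs b_gt1 sv.
have [x _ wx] := smooth_bits_runs b_gt1 sw.
have vw' := lift_valid n_gt0 le2 vw vv.
have := valid_ext 4 (lift_valid n_gt0 le3 wx vw').
by rewrite v0; case: (w 0).
Qed.

Lemma level3_start u1 u v : smooth_bits b v -> runs b u1 u -> runs b u v -> u1 0 = true ->
  u 0 = false ->
  minimal_at ((tt, false) : state 1) u1 0 -> v 0 = true.
Proof.
move=> sv u1u uv u10 u0 minu1; apply/negP => /negP/negbTE v0.
have minu : minimal_at s2 u 1.
  by have := lift_minimal1 n_gt0 le1 u1u u0 minu1; rewrite u10.
have u_1 : u 1 = true by have := run1 uv; rewrite v0 u0.
(* [((tt, true), false)] is the state of [u] at position 1, where [u] has b; minimality from 1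
   forbids the letter 1 in it. *)
pose ok x (s : state 2) := (s == ((tt, true), false)) ==> x.
have vu : valid ok s2 u.
  move=> i; apply/implyP => /eqP si; apply/negP => /negP/negbTE ui.
  have := minu i 0; rewrite !addn0 si ui u_1 /= u0.
  by move=> /(_ erefl (fun i e => False_ind _ (notF e)) isT).
have [w sw vw] := smooth_bits_runs b_gt1 sv.
have [x _ wx] := smooth_bits_runs b_gt1 sw.
have vv := lift_valid n_gt0 le2 uv vu.
have vw' := lift_valid n_gt0 le3 vw vv.
have := valid_ext 3 (lift_valid n_gt0 (isT : 4 <= 4) wx vw').
by rewrite u0 v0; case: (w 0).
Qed.

(* In this state a long run of 1s would give [u_2] a suffix smaller than its own suffix from position 1. *)
Definition ok_u3 x (s : state 3) := ~~ (x && (s == (((tt, true), false), false))).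

Lemma level3_valid u v : runs b u v ->
  u 0 = false -> v 0 = true -> minimal_at s2 u 1 -> valid ok_u3 s3 v.
Proof.
move=> uv u0 v0 minu i; apply/negP => /andP[vi].
rewrite -[s3]/(s2, false) -{1}u0 (state_at_lift n_gt0 le2 _ uv) => /eqP[si oi].
have b0 : 0 < b by rewrite /b; lia.
have ub : u b = true by have := run1 uv; rewrite v0 u0.
have ut t : t < b -> u t = false.
  by move=> lt_t; rewrite (run0 uv) ?v0.
have uit t : t < b -> u (pos b v i + t) = false.
  by move=> lt_t; rewrite uv ?vi // oi.
have st_1 : state_at s2 u 1 = ((tt, true), false) by rewrite /= u0.
(* From position 1, [u] reads b - 1 letters 1 and then b, whereas the long run at [pos b v i] has
   one more 1. *)
have := minu (pos b v i) b.-1; rewrite si st_1 => /(_ erefl).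
have -> : 1 + b.-1 = b by rewrite add1n prednK.
rewrite ub uit ?prednK // (state_at_const _ ut) iter_b //= => /(_ _ isT) H.
by have := H (fun t lt_t => ltac:(rewrite uit ?ut //; lia)).
Qed.

(* If [u_3] starts with b1, then bb never starts in state [s3]; this excludes all long runs of b in [u_4]. *)
Lemma level4_start u v : smooth_bits b v -> runs b u v -> u 0 = true ->
  minimal_at s3 u 0 -> valid ok_u3 s3 u -> v 0 = true.
Proof.
move=> sv uv u0 minu vu; apply/negP => /negP/negbTE v0.
have u1 : u 1 = false by have := run1 uv; rewrite v0 u0.
have bb m : state_at s3 u m = s3 -> u m -> u m.+1 = false.
  move=> sm um; apply/negP => um1; have := minu m 1; rewrite !addn1 sm um1 u1 /= u0.
  by move=> /(_ erefl) H; have : true = false by apply: H => // -[|//] _; rewrite addn0 um u0.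
pose ok x (s : state 4) := lift_ok ok_u3 x s &&
  ~~ [&& x, s.2 & (s.1 == s3) || (@step 3 true s.1 == s3)].
have vv : valid ok s4 v.
  move=> i; apply/andP; split.
    by have := lift_valid n_gt0 le3 uv vu; rewrite u0; apply.
  have -> : state_at s4 v i = (state_at s3 u (pos b v i), u 0 (+) odd i).
    by rewrite -(state_at_lift n_gt0 le3 s3 uv) u0.
  apply/negP => /and3P[vi li].
  have ut t : t < b -> u (pos b v i + t) = true.
    by move=> lt_t; rewrite uv ?vi // li.
  have ut0 : u (pos b v i) = true by rewrite -(ut 0) ?addn0 // /b; lia.
  have ut1 : u (pos b v i).+1 = true by rewrite -addn1 ut // /b; lia.
  have ut2 : u (pos b v i).+2 = true by rewrite -addn2 ut // /b; lia.
  rewrite [_.1]/=; case/orP => /eqP e; first by have := bb _ e ut0; rewrite ut1.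
  have stS : state_at s3 u (pos b v i).+1 = s3.
    by rewrite state_atS ut0.
  by have := bb _ stS ut1; rewrite ut2.
have [w sw vw] := smooth_bits_runs b_gt1 sv.
(* As [v] starts with 1, its runs of b have odd index; [ok] forbids a long one whatever the state at
   its start. *)
apply: (@no_short_class w true sw) => k odd_k; apply/negP => wk.
have := lift_valid n_gt0 (isT : 4 <= 4) vw vv k.
rewrite (state_at_lift n_gt0 (isT : 4 <= 4) _ vw) wk v0 odd_k.
by case: (state_at _ _ _) => [[[[[]]]]] [] [] [] [].
Qed.

(* If [u_4] starts with a long run, the suffix from position 4, in the same state, is smaller. *)
Lemma level5_start u v : runs b u v -> u 0 = true -> minimal_at s4 u 0 -> v 0 = false.
Proof.
move=> uv u0 minu; apply/negP => v0.
have ub : u b = false by have := run1 uv; rewrite v0 u0.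
have ut t : t < b -> u t = true.
  by move=> lt_t; rewrite (run0 uv) ?v0.
have b4 : 4 + (b - 4) = b by rewrite /b; lia.
have := minu 4 (b - 4); rewrite b4 add0n ub.
have -> : state_at s4 u 4 = s4 by rewrite (@state_at_const _ _ _ true) // => i i4; apply: ut; rewrite /b; lia.
have -> : state_at s4 u (b - 4) = iter 2 (step true) s4.
  rewrite (@state_at_const _ _ _ true) => [|i ib]; last by apply: ut; lia.
  by rewrite -(@step4 4 true (iter _ _ _)) // -iterD b4 iter_b.
rewrite ut; last by rewrite /b; lia.
move=> /(_ erefl) H; have : false = true; last by [].
by apply: H => // i ib; rewrite !ut //; lia.
Qed.

(* The automaton forces [u] to start with (1b)^(b/2) 1^b; since b/2 is odd, the state reached then excludes b. *)
Lemma level5_dead u : smooth_bits b u -> u 0 = false -> ~ valid (lift_ok (lift_ok ok_u3)) s5 u.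
Proof.
move=> su u0 vu.
have [v sv uv] := smooth_bits_runs b_gt1 su.
have [w _ vw] := smooth_bits_runs b_gt1 sv.
(* The other letter has no valid continuation by 8 letters. *)
have u1 : u 1 = true.
  have := valid_next 8 1 vu; rewrite state_atS state_at0 u0.
  by case: (u 1); vm_compute.
have u2 : u 2 = false.
  have := valid_next 8 2 vu.
  rewrite !state_atS state_at0 u0 u1.
  by case: (u 2); vm_compute.
have v0 : v 0 = false.
  by apply/negP => v0; have := run0 uv (j := 1); rewrite v0 u0 u1 => /(_ b_gt1).
have v1 : v 1 = false.
  apply/negP => v1; have := uv 1 1; rewrite pos1 v0 v1 u0 u2.
  by move=> /(_ b_gt1).
have w0 : w 0 = true.
  apply/negP => /negP/negbTE w0; have := run1 vw.
  by rewrite w0 v0 v1.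
have vt t : t < b -> v t = false.
  by move=> lt_t; rewrite (run0 vw) ?w0.
have vb : v b = true.
  by have := run1 vw; rewrite w0 v0.
have posE t : t <= b -> pos b v t = t.
  by elim: t => [|t IHt] lt_t; rewrite ?posS ?IHt 1?ltnW ?vt ?addn1 // pos0.
have ut t : t <= b -> u t = odd t.
  by move=> le_t; rewrite -{1}(posE t le_t) (runs0 _ uv) u0.
have eb : odd b = false by rewrite /b mul2n odd_double.
have ubt t : t < b -> u (b + t) = false.
  by move=> lt_t; rewrite -{1}(posE b (leqnn _)) uv ?vb // u0 eb.
have u2b : u (b + b) = true.
  by have := runs0 b.+1 uv; rewrite posS posE // vb u0 /= eb.
have bE : b = 4 * n + 2 by rewrite /b mulnDr mulnA.
have u_4 q i : 4 * q + i <= b -> u (4 * q + i) = odd i.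
  by move/ut->; rewrite oddD oddM.
(* The block 1b1b fixes [s5], and b = 4n + 2 leaves one further pair 1b. *)
have st4 q : 4 * q <= b -> state_at s5 u (4 * q) = s5.
  elim: q => // q IHq; rewrite mulnSr => le_q.
  have e i : i < 4 -> u (4 * q + i) = odd i.
    by move=> i4; apply: u_4; apply: leq_trans le_q; rewrite leq_add2l ltnW.
  rewrite state_at_add IHq; last exact: leq_trans (leq_addr _ _) le_q.
  by rewrite !state_atS state_at0 !e //; vm_compute.
have stb : state_at s5 u b = step true (step false s5).
  rewrite bE state_at_add st4; last by rewrite bE leq_addr.
  by rewrite !state_atS state_at0 !u_4 // bE ?leq_add2l.
(* This state is of level 5, beyond [step4], so its return after four letters 1 is computed. *)
have st2b : state_at s5 u (b + b) = iter 2 (step false) (step true (step false s5)).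
  by rewrite state_at_add stb (state_at_const _ ubt); apply: iter_b; vm_compute.
have := valid_next 3 (b + b) vu; rewrite st2b u2b.
by vm_compute.
Qed.

Lemma no_lyndon u : smooth_bits b u -> ~ lyndon_bits u.
Proof.
move=> su0 lu; have u0 := no_lyndon_start su0 lu.
have [u1 su1 r1] := smooth_bits_runs b_gt1 su0.
have [u2 su2 r2] := smooth_bits_runs b_gt1 su1.
have [u3 su3 r3] := smooth_bits_runs b_gt1 su2.
have [u4 su4 r4] := smooth_bits_runs b_gt1 su3.
have [u5 su5 r5] := smooth_bits_runs b_gt1 su4.
have min0 : minimal_at (tt : state 0) u 0.
  by move=> m j _ eqj neqj; apply: lu.
have min1 : minimal_at ((tt, false) : state 1) u1 0.
  by have := lift_minimal n_gt0 (isT : 0 <= 4) r1; rewrite u0; apply; rewrite pos0.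
have u10 := level1_start su1 min1.
have u20 := level2_start su2 r2 u10 min1.
have min2 : minimal_at s2 u2 0.
  by have := lift_minimal n_gt0 le1 r2; rewrite u10; apply; rewrite pos0.
have min21 : minimal_at s2 u2 1.
  by have := lift_minimal1 n_gt0 le1 r2 u20 min1; rewrite u10.
have u30 := level3_start su3 r2 r3 u10 u20 min1.
have min3 : minimal_at s3 u3 0.
  by have := lift_minimal n_gt0 le2 r3; rewrite u20; apply; rewrite pos0.
have val3 := level3_valid r3 u20 u30 min21.
have u40 := level4_start su4 r4 u30 min3 val3.
have min4 : minimal_at s4 u4 0.
  by have := lift_minimal n_gt0 le3 r4; rewrite u30; apply; rewrite pos0.
have u50 := level5_start r5 u40 min4.
apply: (level5_dead su5 u50).
have := lift_valid n_gt0 (isT : 4 <= 4) r5 (lift_valid n_gt0 le3 r4 val3).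
by rewrite u30 u40.
Qed.

End Main.

Theorem theorem33 (n : nat) :
  ~ exists w : word, smooth (2 * (2 * n + 1)) w /\ infinite_Lyndon w.
Proof.
case=> w [sw lw]; set b := 2 * (2 * n + 1) in sw.
have b_gt1 : 1 < b by rewrite /b; lia.
have sb : smooth_bits b (fun i => w i == b) by exists w.
have lb := smooth_bits_lyndon sw lw b_gt1.
case: n @b sw b_gt1 sb lb => [|n] b sw b_gt1 sb lb; first exact: no_lyndon2 sb lb.
exact: no_lyndon sb lb.
Qed.
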